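(* Let $P$ and $P'$ be the original and the observed point clouds in $\mathbb{R}^d$ with standard Gaussian noise, let $\hat P$ be the compressed point cloud of $P'$ by normalized PCA, and let persistence diagrams be computed with the Rips filtration. Then for every integer $N$ with $0\le N\le n-2$, $$d_B\big(\bar{\mathrm D}_N(P),\bar{\mathrm D}_N(\hat P)\big)=O_{\mathbb P}(1)$$ as $d\to\infty$. Moreover, suppose that $\mathrm D_N(P)$ is non-empty and that $\mathrm D_N(\hat P)$ is non-empty almost surely. Then $$d_H\big(\mathrm D_N(P),\mathrm D_N(\hat P)\big)=O_{\mathbb P}(1)$$ as $d\to\infty$.
   Context: Setting. Fix integers $n>3$ and $1\le s<n$ and let $d>n$ tend to infinity ($n,s$ do not depend on $d$). The original point cloud is $P=\{x_1,\dots,x_n\}\subset\mathbb{R}^d$ with $x_i=(x_{1i},\dots,x_{si},0,\dots,0)^T$, where the numbers $x_{ki}$ are fixed and do not depend on $d$. The noise is $E=\{e_1,\dots,e_n\}$ with $e_1,\dots,e_n$ i.i.d. following $\mathcal N_d(0,I_d)$. The observed point cloud is $P'=\{x_1',\dots,x_n'\}$, $x_i'=x_i+e_i$. Normalized PCA. Let $\overline{x'}=n^{-1}\sum_i x_i'$ and $S_{P'}=\frac1{n-1}\sum_i(x_i'-\overline{x'})(x_i'-\overline{x'})^T$ be the sample covariance matrix, with largest eigenvalues $\lambda_1\ge\lambda_2\ge\cdots$ and corresponding orthonormal eigenvectors $h_1,h_2,\dots$. The compressed point cloud by normalized PCA is $\hat P=\{\hat x_1,\dots,\hat x_n\}\subset\mathbb{R}^s$,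 $\hat x_i=(\hat x_{1i},\dots,\hat x_{si})^T$, $\hat x_{ki}=\lambda_k^{-1/2}h_k^T(x_i'-\overline{x'})$. Equivalently $\hat x_i=\sqrt{n-1}\,(u_{i1},\dots,u_{is})^T$, where $u_k=(u_{1k},\dots,u_{nk})^T$ is the corresponding unit eigenvector for the $k$-th largest eigenvalue of the dual sample covariance matrix $S_{\mathrm D,P'}=\frac1{n-1}(P'-\overline{P'})^T(P'-\overline{P'})$, with $P'$ viewed as the $d\times n$ matrix $(x_1'\cdots x_n')$ and $\overline{P'}=(\overline{x'}\cdots\overline{x'})$. Persistence diagrams. For a finite point cloud $X$ in a Euclidean space and $r\ge0$, the Rips complex at parameter $r$ is the set of $\sigma\subseteq X$ such that $B_x(r)\cap B_y(r)\ne\emptyset$ for all $x,y\in\sigma$ (closed balls of radius $r$, i.e. $\|x-y\|\le2r$). $\mathrm D_N(X)$ is the $N$-th persistence diagram of this filtration using reduced homology with coefficients in a fixed field: the multiset of birth-death pairs $(b,d)$, $b<d$, in $\mathbb{R}_{\ge0}^2$. $\bar{\mathrm D}_N(X)$ is the disjoint union of $\mathrm D_N(X)$ and all points of the diagonal $\{(x,x):x\ge0\}$, each with infinite multiplicity. $d_B(\bar{\mathrm D}_N(X),\bar{\mathrm D}_N(Y))=\inf_\eta\sup_x\|x-\eta(x)\|_\infty$ over all bijections $\eta:\bar{\mathrm D}_N(X)\to\bar{\mathrm D}_N(Y)$. $d_H$ is the Hausdorff distance in $\mathbb{R}_{\ge0}^2$ with the metric of $\|\cdot\|_\infty$. A sequence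 $X_d$ of random variables satisfies $X_d=O_{\mathbb P}(1)$ if for every $\varepsilon>0$ there are a constant $C$ and an integer $M$ with $\mathbb P(|X_d|\le C)\ge1-\varepsilon$ for all $d>M$. *)

(* Defs.v *)
From HB Require Import structures.
From mathcomp Require Import all_boot all_order all_algebra finmap.
From mathcomp Require Import all_classical all_reals all_analysis.

Set Implicit Arguments.
Unset Strict Implicit.
Unset Printing Implicit Defensive.

Import Order.TTheory GRing.Theory Num.Theory.
Import numFieldNormedType.Exports.

Local Open Scope classical_set_scope.
Local Open Scope ring_scope.

(* Chains are functions {set V} -> F, homogeneous chains of dimension k being
   supported on the sets of cardinality k.+1. A complex is a set of simplices
   that contains the empty simplex, so that the boundary of a vertex is the
   empty simplex: this is the augmented complex, and its homology is the reduced
   homology. Simplices are oriented by the enumeration order of V. *)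
Section Homology.
Variables (F : fieldType) (V : finType).

Definition chain := {ffun {set V} -> F^o}.

Definition elem (sigma : {set V}) : chain :=
  [ffun tau => (tau == sigma)%:R : F^o].

Definition vpos (sigma : {set V}) (v : V) : nat :=
  #|[set w in sigma | (enum_rank w < enum_rank v)%N]|.

Definition boundary_fun (c : chain) : chain :=
  \sum_(sigma : {set V}) c sigma *:
    \sum_(v in sigma) (-1) ^+ vpos sigma v *: elem (sigma :\ v).

Fact boundary_fun_is_linear : linear boundary_fun.
Proof.
move=> a c c'; rewrite /boundary_fun scaler_sumr -big_split /=.
by apply: eq_bigr => sigma _; rewrite !ffunE scalerDl scalerA.
Qed.

HB.instance Definition _ :=
  GRing.isLinear.Build F chain chain *:%R boundary_fun boundary_fun_is_linear.

Definition boundary : 'End(chain) := linfun boundary_fun.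

Implicit Types K L : {set {set V}}.

Definition chains_of_card (m : nat) K : {vspace chain} :=
  (\sum_(sigma in K | #|sigma| == m) <[elem sigma]>)%VS.

Definition cycles (N : nat) K : {vspace chain} :=
  (chains_of_card N.+1 K :&: lker boundary)%VS.

Definition boundaries (N : nat) K : {vspace chain} :=
  (boundary @: chains_of_card N.+2 K)%VS.

(* Rank of H_N(K) -> H_N(L) for K contained in L: the image of this map is
   Z_N(K) / (Z_N(K) \cap B_N(L)). *)
Definition persistent_betti (N : nat) K L : nat :=
  (\dim (cycles N K) - \dim (cycles N K :&: boundaries N L))%N.

End Homology.

Section PersistenceDiagrams.
Variable R : realType.

Definition enorm m (v : 'cV[R]_m) : R := Num.sqrt (\sum_i v i 0 ^+ 2).

(* For r < 0 only the empty simplex is left. *)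
Definition rips m (X : {fset 'cV[R]_m}) (r : R) : {set {set X}} :=
  [set sigma : {set X} | [forall x in sigma, forall y in sigma,
    `[< exists z : 'cV[R]_m,
          enorm (val x - z) <= r /\ enorm (val y - z) <= r >]]].

Definition rips_lt m (X : {fset 'cV[R]_m}) (r : R) : {set {set X}} :=
  [set sigma : {set X} | `[< exists2 r', r' < r & sigma \in rips X r' >]].

(* A persistence diagram is given by its multiplicity function. The number of
   N-dimensional classes born at b and dying when entering d is
     (beta(b, d-) - beta(b, d)) - (beta(b-, d-) - beta(b-, d)),
   where beta is the persistent Betti number and r- stands for the union of the
   complexes at the parameters r' < r. The three subtractions on nat never
   truncate. All points have d < +oo, since the reduced homology of the
   Rips complex of a non-empty cloud vanishes at large parameters. *)
Definition diagram (F : fieldType) m (X : {fset 'cV[R]_m}) (N : nat)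
    (p : R * R) : nat :=
  let beta := @persistent_betti F X N in
  let: (b, d) := p in
  if (0 <= b) && (b < d) then
    ((beta (rips X b) (rips_lt X d) - beta (rips X b) (rips X d)) -
     (beta (rips_lt X b) (rips_lt X d) - beta (rips_lt X b) (rips X d)))%N
  else 0%N.

Implicit Types D : R * R -> nat.

Definition support_set D : set (R * R) := [set p | (0 < D p)%N].

(* Points of the diagram counted with multiplicity, together with countably many
   copies of every (x, x) with x >= 0. *)
Definition full_diagram D : Type :=
  ({p : R * R & 'I_(D p)} + {x : R | 0 <= x} * nat)%type.

Definition position D (a : full_diagram D) : R * R :=
  match a with
  | inl u => projT1 u
  | inr v => (sval v.1, sval v.1)
  end.

(* In both distances `|p - q| is the norm of the product R * R, that is, the
   sup norm. *)
Definition bottleneck D1 D2 : \bar R :=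
  ereal_inf [set ereal_sup
      [set (`|position a - position (eta a)|)%:E | a in [set: full_diagram D1]]
    | eta in [set eta : full_diagram D1 -> full_diagram D2 | bijective eta]].

Definition hausdorff (A B : set (R * R)) : \bar R :=
  Order.max
    (ereal_sup [set ereal_inf [set (`|p - q|)%:E | q in B] | p in A])
    (ereal_sup [set ereal_inf [set (`|p - q|)%:E | p in A] | q in B]).

End PersistenceDiagrams.

Section Probability.
Variable R : realType.

Definition mutually_independent (dT dS : measure_display)
    (T : measurableType dT) (S : measurableType dS) (Pr : probability T R)
    (I : finType) (X : I -> {RV Pr >-> S}) : Prop :=
  forall (J : {set I}) (A : I -> set S), (forall i, measurable (A i)) ->
    Pr (\bigcap_(i in [set` J]) (X i @^-1` A i)) =
    (\prod_(i in J) Pr (X i @^-1` A i))%E.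

Definition coordinate (dT : measure_display) (T : measurableType dT)
    (Pr : probability T R) d
    (Y : {RV Pr >-> d.-tuple (measurableTypeR R)}) (j : 'I_d) (w : T) :
    measurableTypeR R :=
  tnth (Y w) j.

Fact coordinate_measurable (dT : measure_display) (T : measurableType dT)
    (Pr : probability T R) d
    (Y : {RV Pr >-> d.-tuple (measurableTypeR R)}) (j : 'I_d) :
  measurable_fun setT (coordinate Y j).
Proof.
exact: (measurableT_comp (measurable_tnth j) (measurable_funPT Y)).
Qed.

HB.instance Definition _ (dT : measure_display) (T : measurableType dT)
    (Pr : probability T R) d
    (Y : {RV Pr >-> d.-tuple (measurableTypeR R)}) (j : 'I_d) :=
  isMeasurableFun.Build _ _ T (measurableTypeR R) (coordinate Y j)
    (coordinate_measurable Y j).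

(* Y ~ N_d(0, I_d). *)
Definition standard_gaussian (dT : measure_display) (T : measurableType dT)
    (Pr : probability T R) d
    (Y : {RV Pr >-> d.-tuple (measurableTypeR R)}) : Prop :=
  mutually_independent (fun j => coordinate Y j : {RV Pr >-> measurableTypeR R})
  /\ forall (j : 'I_d) (A : set (measurableTypeR R)), measurable A ->
       distribution Pr (coordinate Y j : {RV Pr >-> measurableTypeR R}) A =
       normal_prob 0 1 A.

(* The event {|X_d| <= C} need not be measurable for the random variables of
   interest (eigenvectors are chosen arbitrarily), so its probability is bounded
   below through a measurable subset. For measurable X_d this is the usual
   definition of O_P(1). *)
Definition bounded_in_probability (disp : nat -> measure_display)
    (T : forall d, measurableType (disp d)) (Pr : forall d, probability (T d) R)
    (X : forall d, T d -> \bar R) : Prop :=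
  forall eps : R, 0 < eps -> exists (C : R) (M : nat),
    forall d, (M < d)%N -> exists A : set (T d),
      [/\ measurable A, A `<=` [set w | (`|X d w| <= C%:E)%E]
        & ((1 - eps)%:E <= Pr d A)%E].

End Probability.

Section PCA.
Variable R : realType.

(* The i-th column is x_i = (x_1i, ..., x_si, 0, ..., 0)^T. *)
Definition original s n (x : 'M[R]_(s, n)) d : 'M[R]_(d, n) :=
  \matrix_(j, i) oapp (x ^~ i) 0 (insub (val j)).

Definition observed s n (x : 'M[R]_(s, n)) d (e : 'I_n -> d.-tuple R) :
    'M[R]_(d, n) :=
  original x d + \matrix_(j, i) tnth (e i) j.

Definition cloud m n (Y : 'M[R]_(m, n)) : {fset 'cV[R]_m} :=
  [fset col i Y | i in 'I_n]%fset.

Definition sample_mean d n (Y : 'M[R]_(d, n)) : 'cV[R]_d :=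
  n%:R^-1 *: \sum_i col i Y.

Definition sample_cov d n (Y : 'M[R]_(d, n)) : 'M[R]_d :=
  n.-1%:R^-1 *: \sum_i
    (col i Y - sample_mean Y) *m (col i Y - sample_mean Y)^T.

(* The eigenvalues in nonincreasing order, with multiplicity, and corresponding
   orthonormal eigenvectors, indexed from 0; only the values at indices below d
   are meaningful. *)
Definition eigen_system d (S : 'M[R]_d) (lam : nat -> R) (h : nat -> 'cV[R]_d) :
    Prop :=
  [/\ forall k l, (k <= l)%N -> (l < d)%N -> lam l <= lam k,
      forall k, (k < d)%N -> S *m h k = lam k *: h k
    & forall k l, (k < d)%N -> (l < d)%N ->
        ((h k)^T *m h l) 0 0 = (k == l)%:R].

(* The factor is 0 if lam k = 0, which for k < s < n happens with probability 0
   in the intended setting. *)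
Definition normalized_pca d n s (Y : 'M[R]_(d, n)) (lam : nat -> R)
    (h : nat -> 'cV[R]_d) : 'M[R]_(s, n) :=
  \matrix_(k, i)
    ((Num.sqrt (lam k))^-1 * ((h k)^T *m (col i Y - sample_mean Y)) 0 0).

End PCA.

(* Main.v *)
Require Import Defs.
From mathcomp Require Import all_boot all_order all_algebra finmap.
From mathcomp Require Import all_classical all_reals all_analysis.
From mathcomp Require Import lra.

Set Implicit Arguments.
Unset Strict Implicit.
Unset Printing Implicit Defensive.

Import Order.TTheory GRing.Theory Num.Theory.
Import numFieldNormedType.Exports.

Local Open Scope classical_set_scope.
Local Open Scope ring_scope.

(* Normalized PCA is bounded deterministically: as lam_k is the variance of the
   k-th principal component, every coordinate of the compressed points is at
   most sqrt (n - 1). A cloud contained in the ball of radius C has its diagrams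
   in [0, C]^2, because its Rips complex is the full simplex at parameter C.
   Hence all the distances are at most a constant that does not depend on d; the
   noise only matters for the non-emptiness of the diagram of the compressed
   cloud. *)

(** * Rips filtrations and the location of their diagram points *)

Section Rips.
Context {R : realType} {m : nat}.
Implicit Types (X : {fset 'cV[R]_m}) (r : R).

Lemma rips_mono X r r' : r <= r' -> rips X r \subset rips X r'.
Proof.
move=> rr'; apply/fintype.subsetP => sigma; rewrite !inE.
move=> /forall_inP H; apply/forall_inP => x xs; apply/forall_inP => y ys.
have /forall_inP/(_ y ys)/asboolP[z [xz yz]] := H x xs.
by apply/asboolP; exists z; split; apply: le_trans rr'.
Qed.

Lemma rips_lt_sub X r : rips_lt X r \subset rips X r.
Proof.
apply/fintype.subsetP => sigma; rewrite inE => /asboolP[r' r'r].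
exact/fintype.subsetP/rips_mono/ltW.
Qed.

Lemma rips_sub_lt X r r' : r < r' -> rips X r \subset rips_lt X r'.
Proof.
move=> rr'; apply/fintype.subsetP => sigma sr; rewrite inE.
by apply/asboolP; exists r.
Qed.

Lemma rips_full X r : {in X, forall v, enorm v <= r} ->
  rips X r = [set: {set X}]%SET.
Proof.
move=> Xr; apply/setP => sigma; rewrite !inE.
apply/forall_inP => x _; apply/forall_inP => y _; apply/asboolP; exists 0.
by rewrite !subr0; split; apply/Xr/valP.
Qed.

(** For [r < r'], [rips_lt X r'] is squeezed between [rips X r] and [rips X r'], so equality of
    these two would make [r'] uncritical. Hence a critical parameter is encoded by its complex. *)
Lemma rips_critical_inj X r r' : rips X r != rips_lt X r ->
  rips X r' != rips_lt X r' -> rips X r = rips X r' -> r = r'.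
Proof.
wlog rr' : r r' / r < r' => [hw|].
  move=> cr cr' e; have [lt|lt|//] := ltgtP r r'; first exact: hw.
  exact/esym/hw.
move=> _ /eqP cr' e; exfalso; apply: cr'; apply/eqP.
by rewrite finset.eqEsubset rips_lt_sub andbT -{1}e rips_sub_lt.
Qed.

Variables (F : fieldType) (X : {fset 'cV[R]_m}) (N : nat).
Local Notation D := (diagram F X N).

(** If the complex does not change at [b], the two differences defining the multiplicity coincide;
    if it does not change at [d], both of them vanish. *)
Lemma diagram_gt0 b d : (0 < D (b, d))%N ->
  [/\ 0 <= b, b < d, rips X b != rips_lt X b & rips X d != rips_lt X d].
Proof.
rewrite /diagram; case: ifPn => // /andP[b0 bd] D0; split => //.
  by apply: contraTneq D0 => ->; rewrite subnn.
by apply: contraTneq D0 => ->; rewrite !subnn.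
Qed.

Lemma diagram_bounded C p : {in X, forall v, enorm v <= C} -> (0 < D p)%N ->
  0 <= p.1 <= C /\ 0 <= p.2 <= C.
Proof.
case: p => b d XC /diagram_gt0[b0 bd _ crd] /=.
have dC : d <= C.
  (* Beyond [C] the complex is already full before [d], so [d] cannot be critical. *)
  rewrite leNgt; apply: contra crd => Cd.
  rewrite finset.eqEsubset rips_lt_sub andbT.
  apply: fintype.subset_trans (rips_sub_lt X Cd).
  by rewrite (rips_full XC) finset.subsetT.
by rewrite b0 dC (le_trans (ltW bd) dC) (le_trans b0 (ltW bd)).
Qed.

(** A point counted with multiplicity is determined by its two critical complexes, which lie in a
    finite type, and by its index among the copies. *)
Lemma diagram_countable : countable [set: {p : R * R & 'I_(D p)}].
Proof.
pose key (u : {p : R * R & 'I_(D p)}) :=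
  ((rips X (projT1 u).1, rips X (projT1 u).2), nat_of_ord (projT2 u)).
apply/countable_injP; exists (choice.pickle \o key) => u v _ _ /(pcan_inj choice.pickleK).
case: u v => [[b d] i] [[b' d'] j]; rewrite /key /= => -[eb ed ij].
have [_ _ cb cd] := diagram_gt0 (leq_ltn_trans (leq0n _) (ltn_ord i)).
have [_ _ cb' cd'] := diagram_gt0 (leq_ltn_trans (leq0n _) (ltn_ord j)).
have ? := rips_critical_inj cb cb' eb; have ? := rips_critical_inj cd cd' ed.
by subst b' d'; congr existT; apply: val_inj.
Qed.

End Rips.

(** * Bottleneck and Hausdorff distances of diagrams in a square *)

Section Distances.
Context {R : realType}.
Implicit Types (D : R * R -> nat) (C : R).

Definition supported_in_square C D :=
  forall p, (0 < D p)%N -> 0 <= p.1 <= C /\ 0 <= p.2 <= C.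

Lemma square_dist C (p q : R * R) : 0 <= p.1 <= C /\ 0 <= p.2 <= C ->
  0 <= q.1 <= C /\ 0 <= q.2 <= C -> `|p - q| <= C.
Proof.
case: p q => [p1 p2] [q1 q2] /= [/andP[? ?] /andP[? ?]] [/andP[? ?] /andP[? ?]].
rewrite prod_normE /= ge_max !ler_norml.
by apply/andP; split; apply/andP; split; lra.
Qed.

Definition zero_nneg : {x : R | 0 <= x} := exist _ 0 (lexx 0).

(* Hilbert's hotel: the countably many copies of (0, 0) absorb the points off
   the diagonal, and the other points of the diagonal are left in place. *)
Lemma full_diagram_hotel C D : 0 <= C -> supported_in_square C D ->
  countable [set: {p : R * R & 'I_(D p)}] ->
  exists2 phi : full_diagram D -> {x : R | 0 <= x} * nat, bijective phi &
    forall a, if (phi a).1 == zero_nneg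
              then 0 <= (position a).1 <= C /\ 0 <= (position a).2 <= C
              else position a = (sval (phi a).1, sval (phi a).1).
Proof.
move=> C0 DC Dcount.
pose hotel : set (full_diagram D) :=
  [set a | if a is inr v then v.1 = zero_nneg else True].
have hotel_nat : (hotel #= [set: nat])%card.
  apply: eq_card_nat.
    have /countable_injP[f finj] := Dcount.
    (* Even codes go to the points off the diagonal, odd codes to the copies of (0, 0). *)
    pose code (a : full_diagram D) : nat :=
      match a with inl u => (f u).*2 | inr v => v.2.*2.+1 end.
    apply/countable_injP; exists code => -[u|[x k]] [u'|[x' k']] //=;
      rewrite !inE /hotel /=.
    - by move=> _ _ /double_inj ?; congr inl; apply: finj; rewrite ?inE.
    - by move=> _ _ /(congr1 odd) /=; rewrite !odd_double.
    - by move=> _ _ /(congr1 odd) /=; rewrite !odd_double.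
    - by move=> -> -> [/double_inj ->].
  pose copy k : full_diagram D := inr (zero_nneg, k).
  apply: (@sub_infinite_set _ (range copy)); first by move=> _ [k _ <-].
  by rewrite (eq_finite_set (inj_card_eq _)) => [/infinite_nat//|k l _ _ []].
have /card_set_bijP[f [_ finj fsurj]] := hotel_nat.
pose phi (a : full_diagram D) : {x : R | 0 <= x} * nat :=
  match a with
  | inr v => if v.1 == zero_nneg then (zero_nneg, f a) else v
  | inl _ => (zero_nneg, f a)
  end.
have phi_hotel a : hotel a -> phi a = (zero_nneg, f a).
  by case: a => [//|[x k]] /= /eqP ->.
have phi_id v : v.1 != zero_nneg -> phi (inr v) = v.
  by move=> /negbTE /= ->.
have off_hotel a : ~ hotel a -> exists2 v, v.1 != zero_nneg & a = inr v.
  by case: a => [u /(_ I)//|v /eqP v0]; exists v.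
exists phi.
  rewrite -setTT_bijective; split => //.
    move=> a b _ _.
    have [ha|/off_hotel[v v0 ->]] := pselect (hotel a);
      have [hb|/off_hotel[w w0 ->]] := pselect (hotel b).
    - by rewrite !phi_hotel// => -[/finj]; apply; rewrite inE.
    - by rewrite phi_hotel// phi_id// => e; rewrite -e eqxx in w0.
    - by rewrite (phi_hotel b)// phi_id// => e; rewrite e eqxx in v0.
    - by rewrite !phi_id// => ->.
  move=> [x k] _; have [->|x0] := eqVneq x zero_nneg.
    have [a ha <-] := fsurj k I.
    by exists a => //; rewrite phi_hotel.
  by exists (inr (x, k)) => //; rewrite phi_id.
case=> [[p i]|[x k]] /=.
  by rewrite eqxx; apply/DC/(leq_ltn_trans (leq0n _) (ltn_ord i)).
by have [->|/negbTE x0] := eqVneq x zero_nneg; rewrite /= ?eqxx ?x0 /= ?lexx.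
Qed.

(** Composing one hotel bijection with the inverse of the other matches points of the square with
    points of the square, at cost at most [C], and every other diagonal point with a copy of itself,
    at cost 0. *)
Lemma bottleneck_bounded C D1 D2 : 0 <= C ->
  supported_in_square C D1 -> supported_in_square C D2 ->
  countable [set: {p : R * R & 'I_(D1 p)}] ->
  countable [set: {p : R * R & 'I_(D2 p)}] ->
  (`|bottleneck D1 D2| <= C%:E)%E.
Proof.
move=> C0 D1C D2C c1 c2.
have [phi1 [psi1 phi1K psi1K] pos1] := full_diagram_hotel C0 D1C c1.
have [phi2 [psi2 phi2K psi2K] pos2] := full_diagram_hotel C0 D2C c2.
rewrite gee0_abs; last first.
  apply: le_ereal_inf_tmp => _ [eta _ <-]; apply: le_ereal_sup_tmp.
  (* Any point would do: it only shows that the supremum is not over the empty set, where it would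
     be [-oo]. *)
  eexists; first by exists (inr (zero_nneg, 0%N)).
  by rewrite lee_fin.
apply: ge_ereal_inf; eexists.
  exists (psi2 \o phi1) => //=.
  by exists (psi1 \o phi2) => a /=; rewrite ?psi2K ?phi1K ?psi1K ?phi2K.
apply: ge_ereal_sup => _ [a _ <-]; rewrite lee_fin /=.
move: (pos1 a) (pos2 (psi2 (phi1 a))); rewrite psi2K.
case: ifP => _; first exact: square_dist.
by move=> -> ->; rewrite subrr normr0.
Qed.

(** Each infimum needs a witness in the other diagram, since an infimum over the empty set is
    [+oo]. *)
Lemma hausdorff_bounded C D1 D2 :
  supported_in_square C D1 -> supported_in_square C D2 ->
  support_set D1 !=set0 -> support_set D2 !=set0 ->
  (`|hausdorff (support_set D1) (support_set D2)| <= C%:E)%E.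
Proof.
move=> D1C D2C [p Dp] [q Dq]; rewrite gee0_abs; last first.
  rewrite /hausdorff le_max; apply/orP; left; apply: le_ereal_sup_tmp.
  eexists; first by exists p.
  by apply: le_ereal_inf_tmp => _ [? _ <-]; rewrite lee_fin.
rewrite /hausdorff ge_max; apply/andP; split; apply: ge_ereal_sup => _ [u Du <-];
  apply: ge_ereal_inf; eexists.
- by exists q.
- by rewrite lee_fin; apply: square_dist; [exact: D1C|exact: D2C].
- by exists p.
- by rewrite lee_fin; apply: square_dist; [exact: D1C|exact: D2C].
Qed.

End Distances.

(** * Norm bounds for the original and the compressed clouds *)

Section Clouds.
Context {R : realType}.

Lemma cloud_enorm m n (Y : 'M[R]_(m, n)) C :
  (forall i, \sum_j Y j i ^+ 2 <= C ^+ 2) -> 0 <= C ->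
  {in cloud Y, forall v, enorm v <= C}.
Proof.
move=> YC C0 v /imfsetP[i _ ->]; rewrite /enorm -(ger0_norm C0) -sqrtr_sqr.
by rewrite ler_wsqrtr//; under eq_bigr do rewrite mxE.
Qed.

Lemma original_sum s n (x : 'M[R]_(s, n)) d i : (s <= d)%N ->
  \sum_j original x d j i ^+ 2 = \sum_k x k i ^+ 2.
Proof.
move=> sd; pose f k := oapp (x ^~ i) 0 (insub k : option 'I_s) ^+ 2.
have -> : \sum_j original x d j i ^+ 2 = \sum_(j < d) f j.
  by apply: eq_bigr => j _; rewrite mxE.
have -> : \sum_k x k i ^+ 2 = \sum_(k < s) f k.
  by apply: eq_bigr => k _; rewrite /f valK.
rewrite (big_ord_widen _ f sd) [LHS](bigID (fun j : 'I_d => (j < s)%N)) /=.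
rewrite [X in _ + X]big1 ?addr0// => j /negbTE js.
by rewrite /f insubF// expr0n.
Qed.

(** This is the sample variance of the projections to [v]: each summand [v^T *m w *m w^T *m v] is
    the square of a scalar. *)
Lemma sample_cov_quad d n (Y : 'M[R]_(d, n)) (v : 'cV[R]_d) :
  (v^T *m (sample_cov Y *m v)) 0 0 =
  n.-1%:R^-1 * \sum_i (v^T *m (col i Y - sample_mean Y)) 0 0 ^+ 2.
Proof.
rewrite /sample_cov -scalemxAl -scalemxAr mxE; congr (_ * _).
rewrite mulmx_suml mulmx_sumr summxE; apply: eq_bigr => i _.
set w := col i Y - _.
rewrite -(mulmxA w) (mulmxA v^T) mxE big_ord1 expr2; congr (_ * _).
by rewrite -[w^T *m v]trmxK trmx_mul trmxK mxE.
Qed.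

Lemma normalized_pca_coord d n s (Y : 'M[R]_(d, n)) lam h : (s <= d)%N ->
  (1 < n)%N -> eigen_system (sample_cov Y) lam h ->
  forall (k : 'I_s) i, normalized_pca s Y lam h k i ^+ 2 <= n.-1%:R.
Proof.
move=> sd n1 [_ eig orth] k i; have kd : (k < d)%N := leq_trans (ltn_ord k) sd.
have n0 : 0 < n.-1%:R :> R by rewrite ltr0n; case: n n1 {Y eig i} => [|[]].
have lamE : n.-1%:R * lam k =
    \sum_i ((h k)^T *m (col i Y - sample_mean Y)) 0 0 ^+ 2.
  rewrite -[RHS](mulVKf (lt0r_neq0 n0)) -sample_cov_quad eig//.
  by rewrite -scalemxAr mxE orth// eqxx mulr1.
rewrite mxE exprMn exprVn.
(* For [lam k <= 0] both the root and its inverse take the default value 0, so the coordinate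
   vanishes. *)
have [lam0|lam0] := leP (lam k) 0.
  by rewrite ler0_sqrtr// expr0n invr0 mul0r ltW.
rewrite sqr_sqrtr; last exact: ltW.
rewrite ler_pdivrMl// [leRHS]mulrC lamE (bigD1 i)//= lerDl.
by apply: sumr_ge0 => j _; exact: sqr_ge0.
Qed.

End Clouds.

(** The same [C] and [M] serve every [eps]; the complement of a measurable null set is the required
    event. *)
Lemma bounded_in_probability_ae (R : realType) (disp : nat -> measure_display)
    (T : forall d, measurableType (disp d)) (Pr : forall d, probability (T d) R)
    (X : forall d, T d -> \bar R) (C : R) (M : nat) :
  (forall d, (M < d)%N -> {ae Pr d, forall w, (`|X d w| <= C%:E)%E}) ->
  bounded_in_probability Pr X.
Proof.
move=> XC eps eps0; exists C, M => d /XC [B [mB B0 XB]].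
exists (~` B); split; first exact: measurableC.
  by move=> w; apply: contra_notP => ?; exact: XB.
by rewrite probability_setC// B0 sube0 lee_fin gerBl ltW.
Qed.

Theorem mainTheorem3 (R : realType) (F : fieldType) (n s : nat)
    (hn : (3 < n)%N) (hs : (1 <= s < n)%N)
    (x : 'M[R]_(s, n))
    (disp : nat -> measure_display)
    (T : forall d : nat, measurableType (disp d))
    (Pr : forall d : nat, probability (T d) R)
    (e : forall d : nat, 'I_n -> {RV (Pr d) >-> d.-tuple (measurableTypeR R)})
    (he_indep : forall d, (n < d)%N -> mutually_independent (e d))
    (he_gauss : forall d, (n < d)%N -> forall i, standard_gaussian (e d i))
    (lam : forall d, T d -> nat -> R)
    (h : forall d, T d -> nat -> 'cV[R]_d)
    (heig : forall d, (n < d)%N -> forall w,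
       eigen_system (sample_cov (observed x (fun i => e d i w))) (lam d w) (h d w))
    (N : nat) (hN : (N <= n - 2)%N) :
  let D d := diagram F (cloud (original x d)) N in
  let Dhat d w :=
    diagram F (cloud (normalized_pca s (observed x (fun i => e d i w)) (lam d w) (h d w))) N in
  bounded_in_probability Pr (fun d w => bottleneck (D d) (Dhat d w))
  /\
  ((forall d, (n < d)%N -> support_set (D d) !=set0) ->
   (forall d, (n < d)%N ->
      {ae Pr d, forall w, support_set (Dhat d w) !=set0}) ->
   bounded_in_probability Pr
     (fun d w => hausdorff (support_set (D d)) (support_set (Dhat d w)))).
Proof.
move=> D Dhat; have /andP[s1 sn] := hs.
(* The two sums bound the squared norms in the original and in the compressed cloud. Adding 1 gives
   [C <= C ^+ 2], so that [C] bounds the norms themselves. *)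
pose C : R := \sum_k \sum_i x k i ^+ 2 + s%:R * n.-1%:R + 1.
have S0 : 0 <= \sum_k \sum_i x k i ^+ 2.
  by apply: sumr_ge0 => k _; apply: sumr_ge0 => i _; exact: sqr_ge0.
have sn0 : 0 <= s%:R * n.-1%:R :> R by rewrite mulr_ge0.
have C1 : 1 <= C by rewrite /C lerDr addr_ge0.
have C0 : 0 <= C := le_trans ler01 C1.
have CC : C <= C ^+ 2 by rewrite expr2 ler_peMr.
have DC d : (n < d)%N -> supported_in_square C (D d).
  move=> nd p; apply: diagram_bounded; apply: cloud_enorm C0 => i.
  rewrite original_sum; last exact: (leq_trans (ltnW sn) (ltnW nd)).
  apply: le_trans CC; rewrite /C -addrA -[leLHS]addr0 lerD ?addr_ge0//.
  apply: ler_sum => k _; rewrite (bigD1 i)//= lerDl.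
  by apply: sumr_ge0 => j _; exact: sqr_ge0.
have DhatC d w : (n < d)%N -> supported_in_square C (Dhat d w).
  move=> nd p; apply: diagram_bounded; apply: cloud_enorm C0 => i.
  apply: le_trans CC; apply: (@le_trans _ _ (s%:R * n.-1%:R)); last first.
    by rewrite /C -addrA addrCA lerDl addr_ge0.
  rewrite mulr_natl -[X in _ *+ X](card_ord s) -sumr_const.
  apply: ler_sum => k _; apply: (normalized_pca_coord _ _ (heig d nd w)).
    exact: (leq_trans (ltnW sn) (ltnW nd)).
  exact: leq_trans hn.
split=> [|D0 Dhat0]; apply: (@bounded_in_probability_ae _ _ _ _ _ C n) => d nd.
  apply: aeW => w; apply: bottleneck_bounded; [exact: C0|exact: DC|exact: DhatC|..];
    exact: diagram_countable.
(* Here the bound holds only almost surely, on the event that the compressed diagram is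
   non-empty. *)
apply: filterS (Dhat0 d nd) => w; apply: hausdorff_bounded (D0 d nd).
  exact: DC.
exact: DhatC.
Qed.
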